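(* We have $$\lim_{n\to\infty}\ \inf_{\beta\in\mathbb{R}^p}P_\beta\left(\beta\in\hat\beta_L - d\,\frac{\lambda_n^*}{n}\mathcal{M}\right) = 1$$ for any $d>1$ and $$\lim_{n\to\infty}\ \inf_{\beta\in\mathbb{R}^p}P_\beta\left(\beta\in\hat\beta_L - d\,\frac{\lambda_n^*}{n}\mathcal{M}\right) = 0$$ for any $d<1$.
   Context: Consider the linear model $y = X\beta+\varepsilon$, where $y$ is the observed $n\times 1$ data vector, $X$ is a non-stochastic real $n\times p$ regressor matrix of full column rank $p$ that changes with $n$ only by appending rows, $\beta\in\mathbb{R}^p$ is the true parameter vector, and the unobserved error $\varepsilon$ has independent and identically distributed components with mean $0$ and finite variance $\sigma^2$ (normality is not assumed). $P_\beta$ denotes probability when the true parameter is $\beta$. Assume $X'X/n \to C$ as $n\to\infty$, with $C$ finite and positive definite. For non-random componentwise tuning parameters $\lambda_{n,j}\ge 0$, the Lasso estimator $\hat\beta_L$ (depending on $n$) is the unique minimizer over $b\in\mathbb{R}^p$ of $\|y-Xb\|^2 + 2\sum_{j=1}^p\lambda_{n,j}|b_j|$. Consistent tuning is assumed: $\lambda_{n,j}/n^{1/2}\to\infty$ for at least one $j$ with $1\le j\le p$, and $\lambda_{n,j}/n\to0$ for all $j=1,\dots,p$, as $n\to\infty$. Let $\lambda_n^* = \max_{1\le j\le p}\lambda_{n,j}$, and let $\lambda_0=(\lambda_{0,1},\dots,\lambda_{0,p})'$ be given by $\lambda_{n,j}/\lambda_n^*\to\lambda_{0,j}\in[0,1]$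 as $n\to\infty$ for each $j=1,\dots,p$. With $\overline{\mathbb{R}} = \mathbb{R}\cup\{-\infty,\infty\}$, for $\zeta\in\overline{\mathbb{R}}^p$ let $$V^\zeta(u) = u'Cu + 2\sum_{j=1}^p\lambda_{0,j}\left[\mathbf{1}_{\{\zeta_j\in\mathbb{R}\}}(|u_j+\zeta_j|-|\zeta_j|) + \mathbf{1}_{\{|\zeta_j|=\infty\}}\mathrm{sgn}(\zeta_j)u_j\right],$$ which has a unique minimizer over $u \in \mathbb{R}^p$, where $\mathbf{1}_{\{\cdot\}}$ is the indicator function and $\mathrm{sgn}(\pm\infty)=\pm1$. Define $$\mathcal{M} = \bigcup_{\zeta\in\overline{\mathbb{R}}^p}\operatorname*{arg\,min}_{u\in\mathbb{R}^p}V^\zeta(u).$$ Notation: for $a\in\mathbb{R}^p$, a scalar $c$ and a set $M\subseteq\mathbb{R}^p$, $a - cM = \{a-cm : m\in M\}$.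
   Formalization: The first limit (d>1) is proved assuming every λ_{0,j}>0, since otherwise M lies in a hyperplane and coverage can be 0; the second limit is proved for -1<d<1 instead of all d<1, since M=-M makes the set depend only on |d|. *)

(* Defs.v *)
From HB Require Import structures.
From mathcomp Require Import all_boot all_order all_algebra.
From mathcomp Require Import all_classical all_reals all_analysis.

Set Implicit Arguments.
Unset Strict Implicit.
Unset Printing Implicit Defensive.

Import Order.TTheory GRing.Theory Num.Theory.
Import numFieldNormedType.Exports.

Local Open Scope classical_set_scope.
Local Open Scope ring_scope.

Definition argmin {T : Type} {R : realType} (f : T -> R) : set T :=
  [set u | forall v, f u <= f v].

Definition quadform {R : realType} {p : nat} (C : 'M[R]_p) (u : 'cV[R]_p) : R :=
  (u^T *m C *m u) 0 0.

Definition posdefmx {R : realType} {p : nat} (C : 'M[R]_p) : Prop :=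
  C^T = C /\ forall u : 'cV[R]_p, u != 0 -> 0 < quadform C u.

(* Squared Euclidean norm; the library norm of a matrix is the max norm. *)
Definition sqnorm2 {R : realType} {n : nat} (v : 'cV[R]_n) : R :=
  \sum_(i < n) v i 0 ^+ 2.

(* Every design matrix is made of the first rows of one fixed sequence. *)
Definition design {R : realType} {p : nat} (x : nat -> 'rV[R]_p) (n : nat)
  : 'M[R]_(n, p) := \matrix_(i < n) x i.

Definition mutually_independent {d : measure_display} {Omega : measurableType d}
    {R : realType} (P : probability Omega R) (X : nat -> {RV P >-> R}) : Prop :=
  forall (J : seq nat) (B : nat -> set R), uniq J ->
    (forall i, measurable (B i)) ->
    P (\bigcap_(i in [set` J]) (X i @^-1` B i)) =
      (\prod_(i <- J) P (X i @^-1` B i))%E.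

Definition identically_distributed {d : measure_display}
    {Omega : measurableType d} {R : realType} (P : probability Omega R)
    (X : nat -> {RV P >-> R}) : Prop :=
  forall (i j : nat) (B : set R), measurable B ->
    distribution P (X i) B = distribution P (X j) B.

Definition iid_errors {d : measure_display} {Omega : measurableType d}
    {R : realType} (P : probability Omega R) (sigma : R)
    (eps : nat -> {RV P >-> R}) : Prop :=
  [/\ mutually_independent eps,
      identically_distributed eps,
      forall i, ('E_P[eps i] = 0)%E &
      forall i, ('V_P[eps i] = (sigma ^+ 2)%R%:E)%E].

Definition response {d : measure_display} {Omega : measurableType d}
    {R : realType} {P : probability Omega R} {p n : nat} (X : 'M[R]_(n, p))
    (beta : 'cV[R]_p) (eps : nat -> {RV P >-> R}) (w : Omega) : 'cV[R]_n :=
  X *m beta + \col_(i < n) eps i w.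

Definition lasso_objective {R : realType} {n p : nat} (X : 'M[R]_(n, p))
    (y : 'cV[R]_n) (lambda : 'cV[R]_p) (b : 'cV[R]_p) : R :=
  sqnorm2 (y - X *m b) + 2 * \sum_(j < p) lambda j 0 * `|b j 0|.

(* The minimizer exists and is unique when X has full column rank and the
   tuning parameters are nonnegative; the default 0 is then never used. *)
Definition lasso {R : realType} {n p : nat} (X : 'M[R]_(n, p))
    (y : 'cV[R]_n) (lambda : 'cV[R]_p) : 'cV[R]_p :=
  xget 0 (argmin (lasso_objective X y lambda)).

Definition lambda_max {R : realType} {p : nat} (lambda : 'cV[R]_p) : R :=
  \big[Num.max/0]_(j < p) lambda j 0.

Definition limit_penalty {R : realType} (z : \bar R) (t : R) : R :=
  match z with
  | r%:E => `|t + r| - `|r|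
  | +oo%E => t
  | -oo%E => - t
  end.

Definition limit_objective {R : realType} {p : nat} (C : 'M[R]_p)
    (lambda0 : 'cV[R]_p) (zeta : 'I_p -> \bar R) (u : 'cV[R]_p) : R :=
  quadform C u + 2 * \sum_(j < p) lambda0 j 0 * limit_penalty (zeta j) (u j 0).

(* Two features of this set bear on coverage.  It is symmetric about 0 (replace
   zeta by - zeta), so c M = |c| M for every scalar c.  It is degenerate when
   some lambda0_j is 0: all its elements m then satisfy (C m)_j = 0. *)
Definition limit_set {R : realType} {p : nat} (C : 'M[R]_p)
    (lambda0 : 'cV[R]_p) : set 'cV[R]_p :=
  \bigcup_(zeta in [set: 'I_p -> \bar R]) argmin (limit_objective C lambda0 zeta).

(* a - c M *)
Definition translate_scaled {R : realType} {p : nat} (a : 'cV[R]_p) (c : R)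
    (M : set 'cV[R]_p) : set 'cV[R]_p := [set a - c *: m | m in M].

(* P_beta is realised as the law, under the single probability P, of the
   response generated with parameter beta. *)
Definition coverage {d : measure_display} {Omega : measurableType d}
    {R : realType} (P : probability Omega R) {p : nat}
    (x : nat -> 'rV[R]_p) (eps : nat -> {RV P >-> R})
    (lambda : nat -> 'cV[R]_p) (M : set 'cV[R]_p) (c : R) (n : nat)
    (beta : 'cV[R]_p) : \bar R :=
  P [set w | translate_scaled
               (lasso (design x n) (response (design x n) beta eps w) (lambda n))
               (c * (lambda_max (lambda n) / n%:R)) M beta].

Definition min_coverage {d : measure_display} {Omega : measurableType d}
    {R : realType} (P : probability Omega R) {p : nat}
    (x : nat -> 'rV[R]_p) (eps : nat -> {RV P >-> R})
    (lambda : nat -> 'cV[R]_p) (M : set 'cV[R]_p) (c : R) (n : nat) : \bar R :=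
  ereal_inf [set coverage x eps lambda M c n beta | beta in [set: 'cV[R]_p]].

(* Main.v *)
Require Import Defs.
From HB Require Import structures.
From mathcomp Require Import all_boot all_order all_algebra.
From mathcomp Require Import all_classical all_reals all_analysis.
From mathcomp Require Import measurable_realfun.
From mathcomp Require Import ring lra.

Set Implicit Arguments.
Unset Strict Implicit.
Unset Printing Implicit Defensive.

Import Order.TTheory GRing.Theory Num.Theory.
Import numFieldNormedType.Exports.
Local Open Scope classical_set_scope.
Local Open Scope ring_scope.

(** Optimality of the lasso at b reads |g_j| <= lambda_j for the score
    g = X^T (y - X b), with g_j = lambda_j when b_j > 0 ([lasso_score]).
    Writing lmax for the largest tuning parameter and u = (n / lmax) (b - beta),
    the normal equations become

      (X^T X / n) u = X^T eps / lmax - g / lmax.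

    On the limit side, the union M of the argmins is the parallelepiped
    { m : |(C m)_j| <= lambda0_j for all j } ([limit_setP]), so beta belongs to
    b - c (lmax / n) M exactly when |(C u)_j| <= |c| lambda0_j for all j
    ([translate_scaledP], [coveredP]).

    Consistent tuning makes the noise disappear at this scale: by Chebyshev,
    P(|(X^T eps)_j| >= delta lmax) is at most
    sigma^2 (X^T X / n)_jj / delta^2 times n / lmax^2, and n / lmax^2 tends to 0
    ([loud_negligible]).  This event does not depend on beta, which is the source
    of uniformity.  Off it, u stays bounded because X^T X / n is close to the
    invertible C, and hence C u = - g / lmax up to an arbitrarily small error,
    simultaneously for all beta ([scaled_error_expansion]).

    If c > 1 and every lambda0_j is positive, then |g_j| / lmax is at most
    lambda_j / lmax, which tends to lambda0_j and so stays below c lambda0_j by a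
    fixed amount, and every beta is covered
    ([uniform_coverage]).  If |c| < 1, take for beta a vector with all coordinates
    so large that b is positive; then g = lambda, and at a coordinate attaining
    the maximum (C u)_j is close to -1, outside the bound |c| lambda0_j <= |c|
    ([no_uniform_coverage]).

    Both the lasso and the limit objectives are a positive definite quadratic
    plus a separable convex term, so a single variational inequality
    ([argmin_penalizedP]) gives the score bounds, the description of M, and the
    Lipschitz dependence of the lasso on the data.  The last point makes coverage
    a closed condition on the error vector, hence an event. *)

(** * Second moments of linear combinations of the errors *)

Section noise.
Context {d : measure_display} {Omega : measurableType d} {R : realType}
  {P : probability Omega R}.
Implicit Types (X Y : {RV P >-> R}).

(** Square integrability has to be extracted from the moments: with mean 0, the
    variance is literally the integral of the square. *)
Lemma Lfun2_finite_variance X (s : R) :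
  ('E_P[X] = 0)%E -> ('V_P[X] = s%:E)%E -> (X : Omega -> R) \in Lfun P 2%:E.
Proof.
move=> EX VX; rewrite inE; apply/andP; split; first exact: mfunP.
rewrite inE /= /finite_norm unlock /=.
have -> : (\int[P]_x (`|(X x)%:E| `^ 2) = s%:E)%E.
  rewrite -VX /variance unlock EX /= unlock; apply: eq_integral => x _.
  rewrite /= [RHS](_ : _ = ((X x - 0) * (X x - 0))%:E)//.
  by rewrite subr0 powR_mulrn// real_normK ?num_real// expr2.
by rewrite poweR_EFin ltey.
Qed.

(** By independence the joint law of (X, Y) agrees with the product of the
    marginal laws on rectangles, hence everywhere; Fubini then separates the
    integral of the product. *)
Lemma expectationM_indep X Y :
  (forall A B : set R, measurable A -> measurable B ->
     P (X @^-1` A `&` Y @^-1` B) = (P (X @^-1` A) * P (Y @^-1` B))%E) ->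
  (X : Omega -> R) \in Lfun P 2%:E -> (Y : Omega -> R) \in Lfun P 2%:E ->
  ('E_P[((X : Omega -> R) * (Y : Omega -> R))%R] = 'E_P[X] * 'E_P[Y])%E.
Proof.
move=> indep X2 Y2.
have Pfin : P setT \is a fin_num := fin_num_measure P _ measurableT.
have X1 := Lfun_subset12 Pfin X2.
have Y1 := Lfun_subset12 Pfin Y2.
have /Lfun1_integrable XY1 := Lfun2_mul_Lfun1 X2 Y2.
pose XY := fun w => (X w, Y w).
have mXY : measurable_fun setT XY.
  by apply/measurable_fun_pairP; split; exact: measurable_funP.
pose prod := fun z : R * R => (z.1 * z.2)%:E.
have mprod : measurable_fun [set: (R * R)%type] prod.
  apply/measurable_EFinP; apply: measurable_funM; [exact: measurable_fst|exact: measurable_snd].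
pose PX := distribution P X; pose PY := distribution P Y.
pose PXY := distribution P (mfun_Sub (mem_set mXY)).
have joint A : measurable A -> (PX \x PY)%E A = PXY A.
  apply: product_measure_unique => B D mB mD.
  by rewrite /PX /PY /distribution /pushforward /= -indep.
have iprod : (PX \x PY)%E.-integrable setT prod.
  apply/integrableP; split => //.
  rewrite (eq_measure_integral PXY) => [|A mA _]; last exact: joint.
  rewrite ge0_integral_distribution //; last first.
    by apply: measurableT_comp.
  by have /integrableP[_] := XY1.
transitivity (\int[PX \x PY]_z prod z)%E.
  rewrite unlock.
  rewrite (eq_measure_integral PXY) => [|A mA _]; last exact: joint.
  by rewrite integral_distribution.
rewrite -integral12_prod_meas1 //.
have iE Z : P.-integrable setT (EFin \o (Z : {RV P >-> R})) ->
    (distribution P Z).-integrable setT EFin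
    /\ (\int[distribution P Z]_x x%:E = 'E_P[Z])%E.
  move=> iZ; split; last by rewrite unlock integral_distribution.
  apply/integrableP; split; first exact/measurable_EFinP.
  rewrite ge0_integral_distribution //; last exact: measurableT_comp.
  by have /integrableP[_] := iZ.
have [iX EX] := iE X ((Lfun1_integrable _ _).1 X1).
have [iY EY] := iE Y ((Lfun1_integrable _ _).1 Y1).
transitivity (\int[PX]_x (x%:E * 'E_P[Y]))%E.
  apply: eq_integral => x _; rewrite -EY -integralZl //=.
rewrite -EX muleC -(@fineK _ 'E_P[Y]) ?expectation_fin_num// -integralZl //.
by apply: eq_integral => x _; rewrite muleC.
Qed.

Definition linear_noise (eps : nat -> {RV P >-> R}) (a : nat -> R) (n : nat)
  : Omega -> R := \sum_(i < n) (a i \o* eps i).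

Lemma indep_pair (eps : nat -> {RV P >-> R}) i j (A B : set R) :
  mutually_independent eps -> i != j -> measurable A -> measurable B ->
  P (eps i @^-1` A `&` eps j @^-1` B) =
    (P (eps i @^-1` A) * P (eps j @^-1` B))%E.
Proof.
move=> indep ij mA mB.
have := indep [:: i; j] (fun k => if k == i then A else B).
rewrite /= inE ij => /(_ erefl); rewrite !big_cons big_nil mule1 eqxx eq_sym.
rewrite (negbTE ij) => <-; last by move=> k; case: ifP.
congr (P _); apply/seteqP; split => w /=.
  move=> [wA wB] k /=; rewrite !inE => /orP[] /eqP ->; rewrite ?eqxx //.
  by rewrite eq_sym (negbTE ij).
move=> h; split; first by have := h i; rewrite /= !inE eqxx; apply.
by have := h j; rewrite /= !inE eqxx orbT eq_sym (negbTE ij); apply.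
Qed.

Lemma iid_Lfun2 (sigma : R) (eps : nat -> {RV P >-> R}) i :
  iid_errors sigma eps -> (eps i : Omega -> R) \in Lfun P 2%:E.
Proof. by case=> _ _ /(_ i) E0 /(_ i); exact: Lfun2_finite_variance. Qed.

Lemma linear_noise_Lfun2 (sigma : R) (eps : nat -> {RV P >-> R}) a n :
  iid_errors sigma eps -> linear_noise eps a n \in Lfun P 2%:E.
Proof.
have l12 : (1 <= 2%:E :> \bar R)%E by rewrite lee1n.
move=> iid; apply: rpred_sum => i _; apply: Lfun_scale; first by rewrite ler1n.
exact: iid_Lfun2 iid.
Qed.

Lemma linear_noise_expectation (sigma : R) (eps : nat -> {RV P >-> R}) a n :
  iid_errors sigma eps -> ('E_P[linear_noise eps a n] = 0)%E.
Proof.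
move=> iid; have l12 : (1 <= 2%:E :> \bar R)%E by rewrite lee1n.
have Pfin : P setT \is a fin_num := fin_num_measure P _ measurableT.
elim: n => [|n IH]; first by rewrite /linear_noise big_ord0 expectation_cst.
rewrite /linear_noise big_ord_recr /= expectationD ?Lfun_subset12 //.
- rewrite IH add0e expectationZl ?(Lfun_subset12 Pfin (iid_Lfun2 _ iid))//.
  by have [_ _ -> _] := iid; rewrite mule0.
- exact: linear_noise_Lfun2 iid.
- by apply: Lfun_scale; [rewrite ler1n|exact: iid_Lfun2 iid].
Qed.

(** The induction on n only meets errors of index below k, which are independent
    of the k-th one. *)
Lemma covariance_linear_noise (sigma : R) (eps : nat -> {RV P >-> R}) a n k :
  iid_errors sigma eps -> (n <= k)%N ->
  covariance P (linear_noise eps a n) (eps k) = 0%E.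
Proof.
move=> iid; have l12 : (1 <= 2%:E :> \bar R)%E by rewrite lee1n.
have Pfin : P setT \is a fin_num := fin_num_measure P _ measurableT.
have L2 i := iid_Lfun2 i iid.
have L1 i := Lfun_subset12 Pfin (L2 i).
elim: n => [|n IH] nk; first by rewrite /linear_noise big_ord0 covariance_cst_l.
rewrite /linear_noise big_ord_recr /= covarianceDl ?IH ?L2 ?(ltnW nk) //.
- rewrite covarianceZl // ?Lfun2_mul_Lfun1 //.
  rewrite covarianceE ?Lfun2_mul_Lfun1 //.
  have [indep _ E0 _] := iid.
  rewrite expectationM_indep ?L2 // => [|A B mA mB].
    by rewrite !E0 mule0 subee // add0e mule0.
  by apply: indep_pair; rewrite // neq_ltn nk.
- exact: linear_noise_Lfun2 iid.
- by rewrite Lfun_scale ?ler1n.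
Qed.

Lemma linear_noise_variance (sigma : R) (eps : nat -> {RV P >-> R}) a n :
  iid_errors sigma eps ->
  ('V_P[linear_noise eps a n] = (sigma ^+ 2 * \sum_(i < n) a i ^+ 2)%:E)%E.
Proof.
move=> iid; have l12 : (1 <= 2%:E :> \bar R)%E by rewrite lee1n.
have Pfin : P setT \is a fin_num := fin_num_measure P _ measurableT.
have L2 i := iid_Lfun2 i iid.
elim: n => [|n IH].
  by rewrite /linear_noise !big_ord0 mulr0 variance_cst.
rewrite /linear_noise !big_ord_recr /= varianceD; first last.
- by rewrite Lfun_scale ?ler1n.
- exact: linear_noise_Lfun2 iid.
rewrite IH covarianceZr ?(covariance_linear_noise _ iid) // ?mule0 ?adde0.
- rewrite varianceZ //; have [_ _ _ ->] := iid.
  by rewrite -EFinM -EFinD mulrDr (mulrC (sigma ^+ 2) (a n ^+ 2)).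
- by apply: Lfun_subset12 => //; exact: linear_noise_Lfun2 iid.
- exact: Lfun_subset12.
- by apply: Lfun2_mul_Lfun1 => //; exact: linear_noise_Lfun2 iid.
Qed.

Lemma linear_noise_tail (sigma : R) (eps : nat -> {RV P >-> R}) a n (r : R) :
  iid_errors sigma eps -> 0 < r ->
  (P [set w | (r <= `|linear_noise eps a n w|)%R]
     <= (sigma ^+ 2 * (\sum_(i < n) a i ^+ 2) / r ^+ 2)%:E)%E.
Proof.
move=> iid r0.
have mW : linear_noise eps a n \in mfun.
  exact: sub_Lfun_mfun (linear_noise_Lfun2 _ _ iid).
have /= := chebyshev (mfun_Sub mW : {RV P >-> R}) r0.
rewrite (linear_noise_expectation _ _ iid) (linear_noise_variance _ _ iid).
rewrite -EFinM mulrC; under eq_set do rewrite subr0.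
by [].
Qed.
End noise.

(** * Convex penalized quadratics *)

Section penalized_quadratic.
Context {R : realType} {p : nat}.
Implicit Types (A C : 'M[R]_p) (u v b z : 'cV[R]_p) (F : 'I_p -> R -> R).

Definition dot u v : R := \sum_(j < p) u j 0 * v j 0.

Lemma dotDl u v z : dot (u + v) z = dot u z + dot v z.
Proof. by rewrite -big_split; apply: eq_bigr => j _; rewrite mxE mulrDl. Qed.

Lemma dotDr u v z : dot z (u + v) = dot z u + dot z v.
Proof. by rewrite -big_split; apply: eq_bigr => j _; rewrite mxE mulrDr. Qed.

Lemma dotZl a u v : dot (a *: u) v = a * dot u v.
Proof. by rewrite mulr_sumr; apply: eq_bigr => j _; rewrite mxE mulrA. Qed.

Lemma dotZr a u v : dot u (a *: v) = a * dot u v.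
Proof. by rewrite mulr_sumr; apply: eq_bigr => j _; rewrite mxE mulrCA. Qed.

Lemma dotNl u v : dot (- u) v = - dot u v.
Proof. by rewrite -scaleN1r dotZl mulN1r. Qed.

Lemma dotNr u v : dot u (- v) = - dot u v.
Proof. by rewrite -scaleN1r dotZr mulN1r. Qed.

Lemma dotC u v : dot u v = dot v u.
Proof. by apply: eq_bigr => j _; rewrite mulrC. Qed.

Lemma dotE u v : dot u v = (u^T *m v) 0 0.
Proof. by rewrite mxE; apply: eq_bigr => j _; rewrite mxE. Qed.

Lemma dot_delta t j v : dot (t *: delta_mx j 0) v = t * v j 0.
Proof.
rewrite dotZl /dot (bigD1 j)//= big1 ?addr0 => [|k kj]; rewrite !mxE.
  by rewrite !eqxx mul1r.
by rewrite (negbTE kj) mul0r.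
Qed.

Lemma quadformE A u : quadform A u = dot u (A *m u).
Proof. by rewrite dotE mulmxA. Qed.

Lemma dot_sym A u v : A^T = A -> dot u (A *m v) = dot v (A *m u).
Proof.
move=> sA; rewrite [LHS]dotC !dotE trmx_mul sA -mulmxA.
by [].
Qed.

Lemma quadformD A u v : A^T = A ->
  quadform A (u + v) = quadform A u + 2 * dot v (A *m u) + quadform A v.
Proof.
move=> sA; rewrite !quadformE mulmxDr !dotDl !dotDr (dot_sym u v sA); ring.
Qed.

Lemma quadformZ A a u : quadform A (a *: u) = a ^+ 2 * quadform A u.
Proof. by rewrite !quadformE -scalemxAr dotZl dotZr mulrA expr2. Qed.

Lemma quadform_ge0 A u : posdefmx A -> 0 <= quadform A u.
Proof.
move=> [_ pA]; have [->|/pA/ltW//] := eqVneq u 0.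
by rewrite quadformE /dot big1 // => j _; rewrite mxE mul0r.
Qed.

Lemma entry_le_norm m n (M : 'M[R]_(m, n)) i j : `|M i j| <= `|M|.
Proof.
rewrite [in leRHS]/Num.Def.normr /= mx_normrE.
exact: (le_bigmax _ (fun ij : 'I_m * 'I_n => `|M ij.1 ij.2|) (i, j)).
Qed.

Lemma norm_le_entry u (c : R) : 0 <= c -> (forall j, `|u j 0| <= c) -> `|u| <= c.
Proof.
move=> c0 uc; rewrite /Num.Def.normr /= mx_normrE.
by apply/bigmax_leP; split => // -[i j] _ /=; rewrite (ord1 j).
Qed.

Lemma norm_sqr_le u (c : R) : 0 <= c -> (forall j, u j 0 ^+ 2 <= c) -> `|u| ^+ 2 <= c.
Proof.
move=> c0 uc; rewrite -(sqr_sqrtr c0) ler_sqr ?nnegrE ?sqrtr_ge0 //.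
by apply: norm_le_entry => [|j]; rewrite ?sqrtr_ge0// -sqrtr_sqr ler_wsqrtr.
Qed.

Lemma dot_le_norm u v : `|dot u v| <= p%:R * (`|u| * `|v|).
Proof.
apply: le_trans (ler_norm_sum _ _ _) _.
have -> : p%:R * (`|u| * `|v|) = \sum_(j < p) `|u| * `|v|.
  by rewrite sumr_const card_ord mulr_natl.
apply: ler_sum => j _.
by rewrite normrM ler_pM ?normr_ge0 ?entry_le_norm.
Qed.

Lemma mulmx_norm_le m n (M : 'M[R]_(m, n)) (v : 'cV[R]_n) j :
  `|(M *m v) j 0| <= n%:R * (`|M| * `|v|).
Proof.
rewrite mxE; apply: le_trans (ler_norm_sum _ _ _) _.
have -> : n%:R * (`|M| * `|v|) = \sum_(k < n) `|M| * `|v|.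
  by rewrite sumr_const card_ord mulr_natl.
by apply: ler_sum => k _; rewrite normrM ler_pM ?normr_ge0 ?entry_le_norm.
Qed.

Lemma posdefmx_unit A : posdefmx A -> A \in unitmx.
Proof.
move=> [sA pA]; rewrite -row_free_unit; apply: inj_row_free => w wA.
apply/eqP; apply: contraT => w0.
have /pA : w^T != 0 by apply: contraNneq w0 => /(congr1 trmx); rewrite trmxK trmx0 => ->.
by rewrite /quadform trmxK wA mul0mx mxE ltxx.
Qed.

(** Each coordinate is u_j = <w_j, u> in the inner product defined by A, where
    w_j = A^-1 e_j, so Cauchy-Schwarz bounds u_j^2 by A(w_j) A(u). *)
Lemma quadform_coercive A : posdefmx A ->
  exists2 k : R, 0 < k & forall u, k * `|u| ^+ 2 <= quadform A u.
Proof.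
move=> dA; have [sA pA] := dA.
have uA := posdefmx_unit dA.
pose w j := invmx A *m (delta_mx j 0 : 'cV[R]_p).
have Aw j : A *m w j = delta_mx j 0 by rewrite mulmxA mulmxV // mul1mx.
have q0 j : 0 < quadform A (w j).
  apply: pA; apply/eqP => w0; have := Aw j; rewrite w0 mulmx0 => /matrixP/(_ j 0).
  by rewrite !mxE !eqxx => /esym/eqP; rewrite oner_eq0.
pose S := 1 + \sum_j quadform A (w j).
have S0 : 0 < S by rewrite ltr_pwDl // sumr_ge0 // => j _; rewrite ltW.
exists S^-1 => [|u]; first by rewrite invr_gt0.
rewrite mulrC ler_pdivrMr //; apply: norm_sqr_le => [|j].
  by rewrite mulr_ge0 ?(ltW S0) ?quadform_ge0.
apply: (@le_trans _ _ (quadform A u * quadform A (w j))).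
  (* Cauchy-Schwarz: the form is nonnegative at the residual of u after its
     projection on w_j. *)
  have : 0 <= quadform A (u + (- (u j 0 / quadform A (w j))) *: w j).
    exact: quadform_ge0.
  rewrite quadformD // quadformZ dotZl (dot_sym _ _ sA) Aw dotC.
  have -> : dot (delta_mx j 0) u = u j 0.
    by rewrite -[delta_mx j 0](scale1r (delta_mx j 0)) dot_delta mul1r.
  set q := quadform A (w j); set x := u j 0 => h.
  have qp : 0 < q := q0 j.
  have -> : x ^+ 2 = x ^+ 2 / q * q by rewrite mulfVK ?gt_eqF.
  rewrite ler_pM2r // -subr_ge0; apply: le_trans h _.
  rewrite le_eqVlt; apply/orP; left; apply/eqP; field.
  by rewrite gt_eqF.
apply: ler_wpM2l; first exact: quadform_ge0.
rewrite /S (bigD1 j) //= addrCA lerDl addr_ge0 ?ler01 // sumr_ge0 // => k _.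
by rewrite ltW.
Qed.

Definition convex_on_line (f : R -> R) : Prop :=
  forall x y s : R, 0 <= s <= 1 -> f (x + s * (y - x)) <= f x + s * (f y - f x).

(** The common shape of the lasso objective (A = X^T X, z = X^T y) and of the
    limit objective (A = C, z = 0). *)
Definition penalized A z F b : R :=
  quadform A b - 2 * dot b z + 2 * \sum_(j < p) F j (b j 0).

(** A function of s that starts at 0 with slope - 2 m cannot stay nonnegative to
    the right of 0 if m > 0, whatever its curvature. *)
Lemma slope_le0 (c m : R) :
  (forall s : R, 0 < s <= 1 -> 0 <= s ^+ 2 * c - 2 * s * m) -> m <= 0.
Proof.
move=> h; rewrite leNgt; apply/negP => m0.
have D0 : 0 < `|c| + m by rewrite ltr_wpDl.
have s0 : 0 < m / (`|c| + m) by rewrite divr_gt0.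
have s1 : m / (`|c| + m) <= 1 by rewrite ler_pdivrMr // mul1r lerDr.
have := h (m / (`|c| + m)); rewrite s0 s1 => /(_ isT).
set s := m / _ in s0 s1 *.
have sc : s * c <= m.
  apply: le_trans (_ : s * `|c| <= _); first by rewrite ler_wpM2l ?ler_norm ?(ltW s0).
  by rewrite /s mulrAC ler_pdivrMr // ler_wpM2l ?(ltW m0) // lerDl ltW.
have -> : s ^+ 2 * c - 2 * s * m = s * (s * c - 2 * m) by ring.
rewrite pmulr_rge0 //; lra.
Qed.

(** Moving from b towards v by a fraction s changes the smooth part by a term
    linear in s plus s^2 A(v - b), and the convex part by at most s times its total
    increment; letting s tend to 0 leaves the inequality between first-order
    terms.  Conversely that inequality and A >= 0 bound the increment at s = 1. *)
Lemma argmin_penalizedP A z F b : posdefmx A -> (forall j, convex_on_line (F j)) ->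
  argmin (penalized A z F) b <->
  forall v, dot (v - b) (z - A *m b) <= \sum_(j < p) (F j (v j 0) - F j (b j 0)).
Proof.
move=> dA cF; have [sA _] := dA.
have diff v : penalized A z F v - penalized A z F b =
    quadform A (v - b) - 2 * dot (v - b) (z - A *m b)
    + 2 * \sum_(j < p) (F j (v j 0) - F j (b j 0)).
  have [h ->] : exists h, v = b + h by exists (v - b); rewrite subrKC.
  have -> : b + h - b = h by rewrite addrAC subrr add0r.
  rewrite /penalized quadformD // dotDl dotDr dotNr sumrB.
  ring.
split => [bmin v|vi v]; last first.
  rewrite -subr_ge0 diff; have := vi v; have := quadform_ge0 (v - b) dA; lra.
rewrite -subr_le0; apply: (@slope_le0 (quadform A (v - b))) => s /andP[s0 s1].
have := bmin (b + s *: (v - b)).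
rewrite -subr_ge0 diff.
have -> : b + s *: (v - b) - b = s *: (v - b) by rewrite addrAC subrr add0r.
rewrite quadformZ dotZl.
have : \sum_(j < p) (F j ((b + s *: (v - b)) j 0) - F j (b j 0))
    <= s * \sum_(j < p) (F j (v j 0) - F j (b j 0)).
  rewrite mulr_sumr; apply: ler_sum => j _; rewrite !mxE lerBlDl.
  by apply: cF; rewrite ltW.
lra.
Qed.
End penalized_quadratic.

(** * Existence and stability of the minimizer *)

Section minimizers.
Context {R : realType} {p : nat}.
Implicit Types (A C : 'M[R]_p) (u v b z m lam : 'cV[R]_p) (F : 'I_p -> R -> R).

(** Add the two variational inequalities, each tested at the other minimizer: the
    penalties cancel and A(b - b') <= <b - b', z - z'>.  The case z = z' is
    uniqueness. *)
Lemma argmin_penalized_lipschitz A F : posdefmx A ->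
  (forall j, convex_on_line (F j)) ->
  exists2 K : R, 0 <= K & forall z z' b b',
    argmin (penalized A z F) b -> argmin (penalized A z' F) b' ->
    `|b - b'| <= K * `|z - z'|.
Proof.
move=> dA cF; have [k k0 kA] := quadform_coercive dA.
exists (p%:R / k) => [|z z' b b'].
  by rewrite divr_ge0 ?ler0n ?ltW.
move=> /(argmin_penalizedP _ _ dA cF)/(_ b') h /(argmin_penalizedP _ _ dA cF)/(_ b) h'.
have key : quadform A (b - b') <= dot (b - b') (z - z').
  move: h h'; rewrite !sumrB quadformE mulmxBr !dotDl !dotDr !dotNl !dotNr.
  lra.
have {}key : k * `|b - b'| ^+ 2 <= p%:R * (`|b - b'| * `|z - z'|).
  apply: le_trans (kA _) (le_trans key (le_trans (ler_norm _) _)).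
  exact: dot_le_norm.
have [->|n0] := eqVneq `|b - b'| 0.
  by rewrite mulr_ge0 // divr_ge0 ?ler0n ?ltW.
have np : 0 < `|b - b'| by rewrite lt_def n0 normr_ge0.
rewrite mulrAC ler_pdivlMr // -(ler_pM2l np); apply: le_trans (le_trans key _).
  by rewrite expr2 mulrA mulrC mulrA.
by rewrite mulrCA.
Qed.

Lemma penalized_continuous A z F : (forall j, continuous (F j)) ->
  continuous (fun v : 'rV[R]_p => penalized A z F v^T).
Proof.
move=> Fc; have cc j : continuous (fun v : 'rV[R]_p => v 0 j).
  exact: coord_continuous.
have -> : (fun v : 'rV[R]_p => penalized A z F v^T) = fun v : 'rV[R]_p =>
   \sum_(i < p) v 0 i * (\sum_(j < p) A i j * v 0 j)
   + \sum_(j < p) (- 2 * z j 0) * v 0 j + \sum_(j < p) 2 * F j (v 0 j).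
  apply/funext => v; rewrite /penalized quadformE /dot; congr (_ + _ + _).
  - apply: eq_bigr => i _; rewrite !mxE; congr (_ * _).
    by apply: eq_bigr => j _; rewrite mxE.
  - by rewrite mulr_sumr -sumrN; apply: eq_bigr => i _; rewrite mxE; ring.
  - by rewrite mulr_sumr; apply: eq_bigr => i _; rewrite mxE.
have sc (f : 'I_p -> 'rV[R]_p -> R) : (forall j, continuous (f j)) ->
    continuous (fun w => \sum_(j < p) f j w).
  by move=> fc; apply: continuous_big => //; exact: add_continuous.
have cM (f g : 'rV[R]_p -> R) : continuous f -> continuous g ->
    continuous (fun w => f w * g w).
  by move=> cf cg w; exact: (cvgM (cf w) (cg w)).
have cD (f g : 'rV[R]_p -> R) : continuous f -> continuous g ->
    continuous (fun w => f w + g w).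
  by move=> cf cg w; exact: (cvgD (cf w) (cg w)).
have ck (c : R) : continuous (fun _ : 'rV[R]_p => c).
  by move=> w; apply: cvg_cst; exact: nbhs_filter.
have lc c : continuous (fun w : 'rV[R]_p => \sum_(j < p) c j * w 0 j).
  by apply: (sc (fun j w => c j * w 0 j)) => j; exact: (cM (fun=> c j) (fun w => w 0 j) (ck _) (cc j)).
apply: (cD); last first.
- apply: (sc (fun j w => 2 * F j (w 0 j))) => j; apply: (cM (fun=> 2) (fun w => F j (w 0 j)) (ck _)) => w.
  apply: (@continuous_comp _ _ _ (fun w : 'rV[R]_p => w 0 j) (F j)); first exact: cc.
  exact: Fc.
apply: (cD); last exact: lc.
- apply: (sc (fun i w => w 0 i * \sum_(j < p) A i j * w 0 j)) => i.
  exact: (cM (fun w => w 0 i) (fun w => \sum_(j < p) A i j * w 0 j) (cc i) (lc _)).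
Qed.

(** Outside a box the quadratic term dominates the linear one, so the objective
    exceeds its value 0 at the origin, and a minimizer over the compact box is a
    global one. *)
Lemma penalized_argmin_exists A z F : posdefmx A ->
  (forall j, continuous (F j)) -> (forall j t, 0 <= F j t) ->
  (forall j, F j 0 = 0) -> exists b, argmin (penalized A z F) b.
Proof.
move=> dA Fc F0 F00; have [k k0 kA] := quadform_coercive dA.
(* Beyond this radius k |v|^2 >= 2 p |v| |z| >= 2 <v, z>. *)
pose K := 2 * (p%:R * `|z|) / k.
have K0 : 0 <= K by rewrite divr_ge0 ?(ltW k0)// !mulr_ge0.
pose box := [set v : 'rV[R]_p | forall j, `[- K, K]%classic (v ord0 j)].
have box0 : box 0 by move=> j /=; rewrite mxE in_itv /= oppr_le0 K0.
have cbox : compact box by apply: (@rV_compact R p (fun=> `[- K, K]%classic)) => j; exact: segment_compact.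
have [//||c cbx cmin] := @EVT_min_rV R p (fun w => penalized A z F w^T) box _ cbox.
- by exists 0.
- by apply: continuous_subspaceT => v; exact: penalized_continuous.
exists c^T => v; have [vK|vK] := leP `|v| K.
  have := cmin v^T; rewrite trmxK; apply; rewrite inE => j /=.
  rewrite mxE in_itv /= -ler_norml; exact: le_trans (entry_le_norm _ _ _) vK.
apply: (@le_trans _ _ 0).
  have := cmin 0 (mem_set box0); rewrite trmx0 => /le_trans; apply.
  rewrite /penalized quadformE /dot !big1 ?mulr0 ?subr0 ?addr0 // => j _.
  - by rewrite mxE F00.
  - by rewrite mxE mul0r.
  - by rewrite mxE mul0r.
apply: addr_ge0; last by rewrite mulr_ge0 // sumr_ge0.
rewrite subr_ge0; apply: le_trans (kA v).
apply: le_trans (ler_wpM2l _ (ler_norm _)) _ => //.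
apply: le_trans (ler_wpM2l _ (dot_le_norm _ _)) _ => //.
have -> : 2 * (p%:R * (`|v| * `|z|)) = K * k * `|v|.
  by rewrite /K mulfVK ?gt_eqF //; ring.
rewrite expr2 mulrA ler_wpM2r // mulrC ler_wpM2l ?ltW //.
Qed.
End minimizers.

(** * The limit set is a parallelepiped *)

Section limit_set.
Context {R : realType} {p : nat}.
Implicit Types (C : 'M[R]_p) (m lam : 'cV[R]_p).

Lemma convex_on_line_abs (a : R) : convex_on_line (fun t => `|t + a|).
Proof.
move=> x y s /andP[s0 s1].
have -> : x + s * (y - x) + a = (1 - s) * (x + a) + s * (y + a) by ring.
apply: le_trans (ler_normD _ _) _; rewrite !normrM (ger0_norm s0).
by rewrite ger0_norm ?subr_ge0 // le_eqVlt; apply/orP; left; apply/eqP; ring.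
Qed.

Lemma convex_on_line_scale (c : R) f :
  0 <= c -> convex_on_line f -> convex_on_line (fun t => c * f t).
Proof.
move=> c0 cf x y s hs; have := ler_wpM2l c0 (cf x y s hs).
by congr (_ <= _); ring.
Qed.

Lemma convex_on_line_limit_penalty (z : \bar R) : convex_on_line (limit_penalty z).
Proof.
case: z => [r| |] x y s hs /=; rewrite ?lerD2r.
- by have := @convex_on_line_abs r x y s hs; lra.
- lra.
- lra.
Qed.

Lemma limit_penalty_lip (z : \bar R) (x t : R) :
  limit_penalty z (x + t) - limit_penalty z x <= `|t|.
Proof.
case: z => [r| |] /=.
- have := ler_normD (x + r) t; rewrite addrAC; lra.
- have := ler_norm t; lra.
- have := ler_norm (- t); rewrite normrN; lra.
Qed.

Lemma limit_objectiveE C lam zeta u : limit_objective C lam zeta u =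
  penalized C 0 (fun j t => lam j 0 * limit_penalty (zeta j) t) u.
Proof.
have d0 : dot u 0 = 0 by rewrite /dot big1 // => j _; rewrite mxE mulr0.
rewrite /limit_objective /penalized d0.
by rewrite mulr0 subr0.
Qed.

(** Every limit penalty is 1-Lipschitz, so the variational inequality along the
    coordinate axes forces |(C m)_j| <= lambda0_j.  Conversely the choice
    zeta = - m puts the kink of each penalty at m_j, where its subgradient is the
    whole interval [-lambda0_j, lambda0_j]. *)
Lemma limit_setP C lam m : posdefmx C -> (forall j, 0 <= lam j 0) ->
  limit_set C lam m <-> forall j, `|(C *m m) j 0| <= lam j 0.
Proof.
move=> dC lam0.
have cF zeta j : convex_on_line (fun t => lam j 0 * limit_penalty (zeta j) t).
  by apply: convex_on_line_scale => //; exact: convex_on_line_limit_penalty.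
have E zeta : argmin (limit_objective C lam zeta) m <->
    argmin (penalized C 0 (fun j t => lam j 0 * limit_penalty (zeta j) t)) m.
  by split => h v; have := h v; rewrite !limit_objectiveE.
split => [[zeta _ /E /(argmin_penalizedP _ _ dC (cF zeta)) vi] j|bnd]; last first.
  exists (fun j => (- m j 0)%:E) => //; apply/E.
  apply/(argmin_penalizedP _ _ dC (cF _)) => v; apply: ler_sum => j _ /=.
  rewrite !mxE sub0r subrr normr0 sub0r.
  have -> : lam j 0 * (`|v j 0 - m j 0| - `|- m j 0|) - lam j 0 * - `|- m j 0|
     = lam j 0 * `|v j 0 - m j 0| by ring.
  apply: le_trans (ler_norm _) _; rewrite normrM normrN mulrC ler_wpM2r //.
  by have := bnd j; rewrite !mxE.
have {}vi t : - (t * (C *m m) j 0) <= lam j 0 * `|t|.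
  have := vi (m + t *: delta_mx j 0).
  have -> : m + t *: delta_mx j 0 - m = t *: delta_mx j 0.
    by rewrite addrAC subrr add0r.
  rewrite dot_delta sub0r mxE mulrN => /le_trans; apply.
  rewrite (bigD1 j) //= big1 ?addr0 => [|k kj].
    rewrite !mxE !eqxx mulr1 -mulrBr ler_wpM2l //; exact: limit_penalty_lip.
  by rewrite !mxE (negbTE kj) mulr0 addr0 subrr.
have := vi 1; have := vi (- 1); rewrite normrN normr1 mulr1 mul1r mulN1r opprK.
by move=> h1 h2; rewrite ler_norml; lra.
Qed.

(** For c = 0 both sides say a = beta, by invertibility of C; for c <> 0 divide
    by c and use the symmetry of the bounds. *)
Lemma translate_scaledP C lam (a : 'cV[R]_p) (c : R) (beta : 'cV[R]_p) :
  posdefmx C -> (forall j, 0 <= lam j 0) ->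
  translate_scaled a c (limit_set C lam) beta <->
  forall j, `|(C *m (a - beta)) j 0| <= `|c| * lam j 0.
Proof.
move=> dC lam0; split => [[m /(limit_setP _ dC lam0) bnd <-] j|h].
  rewrite opprB addrC subrK -scalemxAr mxE normrM ler_wpM2l //.
have [c0|c0] := eqVneq c 0.
  exists 0; first by apply/(limit_setP _ dC lam0) => j; rewrite mulmx0 mxE normr0.
  rewrite scaler0 subr0; apply/eqP; rewrite -subr_eq0; apply/eqP.
  have uC := posdefmx_unit dC.
  have C0 : C *m (a - beta) = 0.
    apply/colP => j; apply/eqP; rewrite !mxE -normr_le0.
    by have := h j; rewrite c0 normr0 mul0r !mxE.
  by rewrite -[a - beta](mulKmx uC) C0 mulmx0.
exists (c^-1 *: (a - beta)).
  apply/(limit_setP _ dC lam0) => j.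
  by rewrite -scalemxAr mxE normrM normfV ler_pdivrMl ?normr_gt0.
by rewrite scalerA divff // scale1r opprB addrC subrK.
Qed.
End limit_set.

(** * The lasso: optimality and dependence on the data *)

Section lasso_facts.
Context {R : realType} {n p : nat}.
Variable X : 'M[R]_(n, p).
Implicit Types (y : 'cV[R]_n) (b lam : 'cV[R]_p).

Lemma gram_posdef : \rank X = p -> posdefmx (X^T *m X).
Proof.
move=> rX; split; first by rewrite trmx_mul trmxK.
move=> u u0; rewrite quadformE dotE -mulmxA mulmxA -trmx_mul -dotE.
have Xu : X *m u != 0.
  apply: contraNneq u0 => Xu0.
  have fX : row_free X^T by rewrite /row_free mxrank_tr rX.
  have : u^T *m X^T = 0 *m X^T by rewrite -trmx_mul Xu0 trmx0 mul0mx.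
  by move/(row_free_inj fX)/(congr1 trmx); rewrite trmxK trmx0 => ->.
rewrite lt_def; apply/andP; split; last first.
  by apply: sumr_ge0 => i _; rewrite -expr2 sqr_ge0.
apply: contra Xu; rewrite psumr_eq0 => [/allP h|i _]; last by rewrite -expr2 sqr_ge0.
apply/eqP/colP => i; have := h i (mem_index_enum _).
by rewrite /= mulf_eq0 orbb [RHS]mxE => /eqP.
Qed.

Definition lasso_penalty lam : 'I_p -> R -> R := fun j t => lam j 0 * `|t|.

Lemma lasso_objectiveE y lam b : lasso_objective X y lam b =
  sqnorm2 y + penalized (X^T *m X) (X^T *m y) (lasso_penalty lam) b.
Proof.
have sqE (v : 'cV[R]_n) : sqnorm2 v = dot v v.
  by apply: eq_bigr => i _; rewrite expr2.
have adj (v : 'cV[R]_n) : dot b (X^T *m v) = dot (X *m b) v.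
  by rewrite !dotE trmx_mul mulmxA.
rewrite /lasso_objective /penalized !sqE quadformE -mulmxA !adj.
by rewrite dotDl !dotDr !dotNl !dotNr opprK (dotC y); ring.
Qed.

Lemma argmin_lasso y lam : argmin (lasso_objective X y lam) =
  argmin (penalized (X^T *m X) (X^T *m y) (lasso_penalty lam)).
Proof.
apply/seteqP; split => b h v; have := h v; rewrite !lasso_objectiveE.
  by rewrite lerD2l.
by rewrite -(lerD2l (sqnorm2 y)).
Qed.

Hypothesis dX : posdefmx (X^T *m X).
Variable lam : 'cV[R]_p.
Hypothesis lam0 : forall j, 0 <= lam j 0.

Let cF j : convex_on_line (lasso_penalty lam j).
Proof.
apply: convex_on_line_scale => // x y s hs.
by have := @convex_on_line_abs R 0 x y s hs; rewrite !addr0.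
Qed.

Lemma lasso_argmin y : argmin (lasso_objective X y lam) (lasso X y lam).
Proof.
have [|||b hb] := @penalized_argmin_exists _ _ _ (X^T *m y) (lasso_penalty lam) dX.
- move=> j t; apply: cvgM; first exact: cvg_cst.
  exact: norm_continuous.
- by move=> j t; rewrite mulr_ge0.
- by move=> j; rewrite /lasso_penalty normr0 mulr0.
by apply: (@xgetPex _ _ (argmin _)); exists b; rewrite argmin_lasso.
Qed.

Lemma lasso_lipschitz : exists2 K : R, 0 <= K &
  forall y y', `|lasso X y lam - lasso X y' lam| <= K * `|X^T *m (y - y')|.
Proof.
have [K K0 h] := argmin_penalized_lipschitz dX cF.
exists K => // y y'; rewrite mulmxBr; apply: h; rewrite -argmin_lasso.
  exact: lasso_argmin.
exact: lasso_argmin.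
Qed.

(** The Karush-Kuhn-Tucker conditions, read off from the variational inequality
    by moving the j-th coordinate by 1, by -1 and, to obtain equality at a
    positive coordinate, to 0. *)
Lemma lasso_score y (b := lasso X y lam) (g := X^T *m (y - X *m b)) j :
  `|g j 0| <= lam j 0 /\ (0 < b j 0 -> g j 0 = lam j 0).
Proof.
have := lasso_argmin y; rewrite argmin_lasso => /(argmin_penalizedP _ _ dX cF).
rewrite -/b -mulmxA -mulmxBr -/g => vi.
have {}vi t : t * g j 0 <= lam j 0 * (`|b j 0 + t| - `|b j 0|).
  have := vi (b + t *: delta_mx j 0).
  have -> : b + t *: delta_mx j 0 - b = t *: delta_mx j 0.
    by rewrite addrAC subrr add0r.
  rewrite dot_delta => /le_trans; apply.
  rewrite (bigD1 j) //= big1 ?addr0 => [|k kj].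
    by rewrite /lasso_penalty !mxE !eqxx mulr1 -mulrBr.
  by rewrite !mxE (negbTE kj) mulr0 addr0 subrr.
have vi' t : t * g j 0 <= lam j 0 * `|t|.
  apply: le_trans (vi t) _; rewrite ler_wpM2l // lerBlDl; exact: ler_normD.
have gb : `|g j 0| <= lam j 0.
  have := vi' 1; have := vi' (- 1); rewrite normrN normr1 mulr1 mul1r mulN1r.
  by move=> h1 h2; rewrite ler_norml; lra.
split => // b0; apply/eqP; rewrite eq_le (le_trans (ler_norm _) gb) /=.
have := vi (- b j 0); rewrite subrr normr0 sub0r (gtr0_norm b0) mulrN mulNr lerN2.
by rewrite mulrC ler_pM2l.
Qed.
End lasso_facts.

(** * Coverage is an event *)

Section measurability.
Context {d : measure_display} {Omega : measurableType d} {R : realType}.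

(** An open set is the union of the countably many boxes with rational centre and
    half-width 1 / (k + 1) that it contains, and the preimage of a box is a finite
    intersection of events. *)
Lemma measurable_open_preimage n (Z : 'I_n -> Omega -> R) (U : set 'cV[R]_n) :
  (forall i, measurable_fun setT (Z i)) -> open U ->
  measurable [set w | U (\col_i Z i w)].
Proof.
move=> mZ oU.
pose lo (c : 'cV[rat]_n * nat) i : R := ratr (c.1 i 0) - c.2.+1%:R^-1.
pose hi (c : 'cV[rat]_n * nat) i : R := ratr (c.1 i 0) + c.2.+1%:R^-1.
pose box c := [set v : 'cV[R]_n | forall i, v i 0 \in `]lo c i, hi c i[].
pose G c := [set w | box c `<=` U /\ box c (\col_i Z i w)].
have -> : [set w | U (\col_i Z i w)] = \bigcup_c G c.
  apply/seteqP; split => [w /= Uw|w [c _ [sub bw]]]; last exact: sub.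
  set v := (X in U X) in Uw.
  have /nbhs_ballP[e /= e0 sub] : nbhs v U by exact: open_nbhs_nbhs.
  (* A box of half-width below e / 2 that contains v lies within distance e
     of v. *)
  have [k ke] : exists k : nat, k.+1%:R^-1 < e / 2.
    have [k _ /(_ k (leqnn k))] := near_infty_natSinv_lt (PosNum (divr_gt0 e0 (ltr0Sn R 1))).
    by move=> h; exists k.
  have : 0 < k.+1%:R^-1 :> R by rewrite invr_gt0.
  have [a aE] : exists a : R, a = k.+1%:R^-1 by exists k.+1%:R^-1.
  rewrite -aE in ke *; move=> a0.
  have q_ex i : exists q : rat, `|v i 0 - ratr q| < a.
    have /rat_in_itvoo[q] : v i 0 - a < v i 0 + a by lra.
    rewrite in_itv /= => /andP[h1 h2]; exists q.
    by rewrite ltr_norml; apply/andP; split; lra.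
  have [q qP] := choice q_ex.
  exists (\col_i q i, k) => //; split => [v' bv'|i]; last first.
    have := qP i; rewrite ltr_norml => /andP[h1 h2].
    by rewrite in_itv /= /lo /hi /= -aE !mxE; rewrite !mxE in h1 h2; apply/andP; split; lra.
  apply: sub; split => // i j; rewrite (ord1 j).
  have := bv' i; rewrite in_itv /= /lo /hi /= -aE !mxE => /andP[h1 h2].
  have := qP i; rewrite /v mxE ltr_norml => /andP[h3 h4].
  by rewrite /ball /= ltr_norml; apply/andP; split; lra.
apply: countable_bigcupT_measurable => [|c]; first exact: countableP.
have -> : G c = (if `[< box c `<=` U >] then setT else set0) `&`
    \bigcap_(i in [set: 'I_n]) ([set: Omega] `&` Z i @^-1` [set` `]lo c i, hi c i[]).
  apply/seteqP; split => w /=.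
    move=> [sub bw]; rewrite asboolT //; split => // i _; split => //=.
    by move: (bw i); rewrite /= mxE.
  case: asboolP => [sub [_ h]|_ [[] _]]; split => [|i]; [exact: sub|rewrite mxE].
  by have [] := h i I.
apply: measurableI; first by case: ifP.
apply: fin_bigcap_measurable => [|i _]; first exact: finite_finset.
exact: mZ.
Qed.

Lemma measurable_closed_preimage n (Z : 'I_n -> Omega -> R) (F : set 'cV[R]_n) :
  (forall i, measurable_fun setT (Z i)) -> closed F ->
  measurable [set w | F (\col_i Z i w)].
Proof.
move=> mZ cF; rewrite -[X in measurable X]setCK; apply: measurableC.
by apply: (@measurable_open_preimage n Z (~` F)) => //; exact: closed_openC.
Qed.

(** The constraints are weak inequalities between continuous functions of v, as
    the lasso is Lipschitz in the data. *)
Lemma closed_covered n p (X : 'M[R]_(n, p)) (C : 'M[R]_p) (beta lam : 'cV[R]_p)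
    (thr : 'I_p -> R) :
  posdefmx (X^T *m X) -> (forall j, 0 <= lam j 0) ->
  closed [set v : 'cV[R]_n | forall j,
    `|(C *m (lasso X (X *m beta + v) lam - beta)) j 0| <= thr j].
Proof.
move=> dX lam0; have [K K0 lip] := lasso_lipschitz dX lam0.
pose h j (v : 'cV[R]_n) := (C *m (lasso X (X *m beta + v) lam - beta)) j 0.
have -> : [set v : 'cV[R]_n | forall j, `|h j v| <= thr j] =
    \bigcap_(j in setT) ([set t : R | `|t| <= thr j] \o h j).
  by apply/seteqP; split => v hv j; [move=> _; exact: hv|exact: (hv j I)].
apply: closed_bigI => j _; apply: closed_comp; last first.
  apply: (@closed_comp _ _ (fun t : R => `|t|) [set t | t <= thr j]).
    by move=> t _; exact: norm_continuous.
  exact: closed_le.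
move=> v _; have FF : Filter (nbhs (v : 'cV[R]_n)) by exact: nbhs_filter.
apply/cvgrPdist_le => /= e e0.
pose L := p%:R * (`|C| * (K * (n%:R * `|X^T|))).
have L0 : 0 <= L by rewrite !mulr_ge0.
have near_v : nbhs (v : 'cV[R]_n) [set v' | `|v - v'| < e / (L + 1)].
  apply/(@nbhs_normP R 'cV[R]_n v); exists (e / (L + 1)) => //=.
  by rewrite divr_gt0 // ltr_wpDl.
apply: (@filterS _ (nbhs (v : 'cV[R]_n)) (nbhs_filter _) _ _ _ near_v) => v' /= dv.
have -> : h j v - h j v' =
    (C *m (lasso X (X *m beta + v) lam - lasso X (X *m beta + v') lam)) j 0.
  by rewrite /h !mulmxBr !mxE; ring.
apply: (@le_trans _ _ (L * `|v - v'|)).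
  apply: le_trans (mulmx_norm_le _ _ _) _.
  rewrite /L -!mulrA !ler_wpM2l //; apply: le_trans (lip _ _) _.
  rewrite ler_wpM2l // opprD addrACA subrr add0r.
  by apply: norm_le_entry => [|k]; [rewrite !mulr_ge0|exact: mulmx_norm_le].
apply: le_trans (ler_wpM2l L0 (ltW dv)) _.
by rewrite mulrCA ler_piMr ?(ltW e0) // ler_pdivrMr ?mul1r ?lerDl // ltr_wpDl.
Qed.

End measurability.

(** * Auxiliary estimates on matrices and tuning parameters *)

Section perturbation.
Context {R : realType} {p : nat}.

(** Inverses of matrices near C are bounded uniformly: coercivity of C gives
    k |u|^2 <= <u, A u> + <u, (C - A) u>, and for A close to C the last term is
    absorbed by half of the left-hand side. *)
Lemma perturbed_inverse_bound (C : 'M[R]_p) : posdefmx C ->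
  exists2 K : R, 0 <= K & exists2 eta : R, 0 < eta &
    forall (A : 'M[R]_p) (u : 'cV[R]_p) (c : R), `|C - A| <= eta -> 0 <= c ->
      (forall j, `|(A *m u) j 0| <= c) -> `|u| <= K * c.
Proof.
move=> dC; have [k k0 kC] := quadform_coercive dC.
exists (2 * p%:R / k) => [|]; first by rewrite divr_ge0 ?(ltW k0) // mulr_ge0.
have D0 : 0 < 2 * (p%:R ^+ 2 + 1) :> R.
  by rewrite mulr_gt0 // ltr_wpDl // exprn_ge0.
exists (k / (2 * (p%:R ^+ 2 + 1))) => [|A u c hA c0 hu]; first by rewrite divr_gt0.
have [->|n0] := eqVneq `|u| 0.
  by rewrite mulr_ge0 // divr_ge0 ?(ltW k0) // mulr_ge0.
have np : 0 < `|u| by rewrite lt_def n0 normr_ge0.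
have Au : `|A *m u| <= c by exact: norm_le_entry.
have CAu : `|(C - A) *m u| <= p%:R * (`|C - A| * `|u|).
  by apply: norm_le_entry => [|j]; [rewrite !mulr_ge0|exact: mulmx_norm_le].
have q1 : k * `|u| ^+ 2 <= p%:R * (`|u| * c) + p%:R * (`|u| * (p%:R * (`|C - A| * `|u|))).
  apply: le_trans (kC u) _; rewrite quadformE.
  have -> : C *m u = A *m u + (C - A) *m u by rewrite -mulmxDl addrC subrK.
  rewrite dotDr; apply: lerD; apply: le_trans (ler_norm _) (le_trans (dot_le_norm _ _) _).
    by rewrite !ler_wpM2l.
  by rewrite !ler_wpM2l.
have q2 : p%:R ^+ 2 * `|C - A| <= k / 2.
  apply: (@le_trans _ _ (p%:R ^+ 2 * (k / (2 * (p%:R ^+ 2 + 1))))).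
    by rewrite ler_wpM2l // exprn_ge0.
  rewrite mulrCA ler_pM2l // ler_pdivrMr // mulrA mulVf ?pnatr_eq0 // mul1r.
  by rewrite lerDl.
have q3 : k * `|u| <= p%:R * c + k / 2 * `|u|.
  rewrite -(ler_pM2l np); apply: (@le_trans _ _ (k * `|u| ^+ 2)).
    by rewrite expr2 mulrCA.
  apply: le_trans q1 _; rewrite mulrDr; apply: lerD; first by rewrite mulrCA.
  have -> : p%:R * (`|u| * (p%:R * (`|C - A| * `|u|))) =
    `|u| * (p%:R ^+ 2 * `|C - A| * `|u|) by ring.
  by rewrite ler_pM2l // ler_pM2r.
by rewrite mulrAC ler_pdivlMr //; lra.
Qed.
End perturbation.

Section lambda_max.
Context {R : realType} {p : nat}.
Implicit Types lam : 'cV[R]_p.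

Lemma le_lambda_max lam j : lam j 0 <= lambda_max lam.
Proof. exact: (le_bigmax _ (fun j => lam j 0)). Qed.

Lemma lambda_max_attained lam : 0 < lambda_max lam ->
  exists j, lam j 0 = lambda_max lam.
Proof.
rewrite /lambda_max => pos.
have [j] : exists j, 0 < lam j 0.
  apply: contrapT => h; move: pos; rewrite ltNge => /negP; apply.
  by apply/bigmax_leP; split => // j _; rewrite leNgt; apply/negP => hj; apply: h; exists j.
move=> lamj.
(* A positive entry is needed because the maximum is taken together with 0. *)
pose j1 := [arg max_(i > j) lam i 0]%O.
exists j1; apply/eqP; rewrite eq_le le_lambda_max /=.
apply/bigmax_leP; rewrite /j1; case: arg_maxP => // i _ hi; split.
  by apply: le_trans (hi j isT); rewrite ltW.
by move=> k _; exact: hi.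
Qed.
End lambda_max.

(** * Large noise is improbable *)

Section regression_noise.
Context {d : measure_display} {Omega : measurableType d} {R : realType}
  {P : probability Omega R} {p : nat}.
Implicit Types (x : nat -> 'rV[R]_p) (eps : nat -> {RV P >-> R}).

Definition noise x eps n w : 'cV[R]_p := (design x n)^T *m \col_(i < n) eps i w.

(** The exceptional event; off it, on the quiet outcomes, all later estimates are
    deterministic. *)
Definition loud x eps n (r : R) : set Omega :=
  \bigcup_(j in [set: 'I_p]) [set w | r <= `|noise x eps n w j 0|].

Lemma noiseE x eps n w j :
  noise x eps n w j 0 = linear_noise eps (fun i => x i 0 j) n w.
Proof.
rewrite /linear_noise fct_sumE mxE; apply: eq_bigr => i _.
by rewrite !mxE mulrC.
Qed.

Lemma measurable_noise_entry sigma x eps n j : iid_errors sigma eps ->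
  measurable_fun setT (fun w => noise x eps n w j 0).
Proof.
move=> iid; under eq_fun do rewrite noiseE.
have /sub_Lfun_mfun := linear_noise_Lfun2 (fun i => x i 0 j) n iid.
by rewrite inE.
Qed.

Lemma measurable_loud_entry sigma x eps n r j : iid_errors sigma eps ->
  measurable [set w | r <= `|noise x eps n w j 0|].
Proof.
move=> iid; rewrite -[X in measurable X]setTI.
have -> : [set w | r <= `|noise x eps n w j 0|] =
    (fun w => `|noise x eps n w j 0|) @^-1` `[r, +oo[%classic.
  by apply/seteqP; split => w /=; rewrite in_itv /= andbT.
have mf : measurable_fun setT (fun w => `|noise x eps n w j 0|).
  apply: (@measurableT_comp _ _ _ _ _ _ (fun t : R => `|t|)) => //.
  exact: measurable_noise_entry iid.
exact: mf.
Qed.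

Lemma measurable_loud sigma x eps n r : iid_errors sigma eps ->
  measurable (loud x eps n r).
Proof.
move=> iid; apply: fin_bigcup_measurable => [|j _]; first exact: finite_finset.
exact: measurable_loud_entry iid.
Qed.

(** Chebyshev for each of the p coordinates and a union bound; the variances add
    up to sigma^2 times the trace of the Gram matrix. *)
Lemma loud_prob_le sigma x eps n r : iid_errors sigma eps -> 0 < r ->
  (P (loud x eps n r) <= (sigma ^+ 2 / r ^+ 2 *
      \tr ((design x n)^T *m design x n))%:E)%E.
Proof.
move=> iid r0; pose B j := [set w | r <= `|noise x eps n w j 0|].
have -> : loud x eps n r = \big[setU/set0]_(j < p) B j.
  have -> : loud x eps n r = \bigcup_(j in [set` (predT : pred 'I_p)]) B j.
    by congr bigcup; apply/seteqP; split.
  by rewrite bigcup_pred.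
have : measurable (\big[setU/set0]_(j < p) B j) /\
    (P (\big[setU/set0]_(j < p) B j) <=
      \sum_(j < p) (sigma ^+ 2 / r ^+ 2 * \sum_(i < n) x i 0 j ^+ 2)%:E)%E.
  apply: (big_rec2 (fun S s => measurable S /\ (P S <= s)%E)) => [|j S s _ [mS Ss]].
    by rewrite measure0.
  have mB := measurable_loud_entry x n r j iid.
  split; first exact: measurableU.
  apply: le_trans (measureU2 P mB mS) _; apply: leeD => //.
  rewrite /B; under eq_set do rewrite noiseE.
  apply: le_trans (linear_noise_tail _ _ iid r0) _.
  by rewrite lee_fin mulrAC.
move=> [_] /le_trans; apply; rewrite sumEFin -mulr_sumr lee_fin.
rewrite le_eqVlt; apply/orP; left; apply/eqP; congr (_ * _).
apply: eq_bigr => j _; rewrite mxE; apply: eq_bigr => i _.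
by rewrite !mxE expr2.
Qed.
End regression_noise.

(** * Asymptotics under consistent tuning *)

Section consistent_tuning.
Context {d : measure_display} {Omega : measurableType d} {R : realType}
  {P : probability Omega R} {p : nat}.
Context {x : nat -> 'rV[R]_p} {C : 'M[R]_p} {sigma : R} {eps : nat -> {RV P >-> R}}
  {lambda : nat -> 'cV[R]_p}.

Notation gram n := ((design x n)^T *m design x n).
Notation lmax n := (lambda_max (lambda n)).
Notation score n beta w :=
  ((design x n)^T *m (response (design x n) beta eps w -
     design x n *m lasso (design x n) (response (design x n) beta eps w) (lambda n))).
Notation scaled_error n beta w :=
  ((n%:R / lmax n) *:
     (lasso (design x n) (response (design x n) beta eps w) (lambda n) - beta)).

Hypothesis X_full_rank : \forall n \near \oo, \rank (design x n) = p.
Hypothesis X_gram : (n%:R^-1 *: gram n) @[n --> \oo] --> C.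
Hypothesis C_posdef : posdefmx C.
Hypothesis eps_iid : iid_errors sigma eps.
Hypothesis lambda_ge0 : forall n j, 0 <= lambda n j 0.
Hypothesis lambda_sqrt : exists j, (lambda n j 0 / Num.sqrt n%:R) @[n --> \oo] --> +oo.

Lemma lambda_max_over_sqrt_cvgy : (lmax n / Num.sqrt n%:R) @[n --> \oo] --> +oo.
Proof.
have [j hj] := lambda_sqrt; apply: ger_cvgy hj; apply: nearW => n.
by rewrite ler_wpM2r ?invr_ge0 ?sqrtr_ge0 // le_lambda_max.
Qed.

Lemma lambda_max_gt0 : \forall n \near \oo, 0 < lmax n.
Proof.
have := lambda_max_over_sqrt_cvgy => /cvgryPgt /(_ 0); apply: filterS => n.
have := sqrtr_ge0 (n%:R : R); rewrite le_eqVlt => /orP[/eqP <-|s0].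
  by rewrite invr0 mulr0 ltxx.
by rewrite pmulr_lgt0 ?invr_gt0.
Qed.

Lemma gram_near (e : R) : 0 < e ->
  \forall n \near \oo, `|C - n%:R^-1 *: gram n| <= e.
Proof. by move=> e0; move/cvgrPdist_le : X_gram => /(_ e e0). Qed.

(** The bound of [loud_prob_le] is a convergent factor, the trace of X^T X / n,
    times n / lmax^2, which tends to 0. *)
Lemma loud_negligible (delta : R) : 0 < delta ->
  P (loud x eps n (delta * lmax n)) @[n --> \oo] --> 0%E.
Proof.
move=> d0.
pose rate n : R := (lmax n / Num.sqrt n%:R)^-1.
have rate0 : rate n @[n --> \oo] --> 0.
  apply/gtr0_cvgV0; last exact: lambda_max_over_sqrt_cvgy.
  by move/cvgryPgt : lambda_max_over_sqrt_cvgy => /(_ 0).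
have trC : \tr (n%:R^-1 *: gram n) @[n --> \oo] --> \tr C.
  apply: cvg_big => [|j _]; first exact: add_continuous.
  exact: (cvg_comp _ (fun M : 'M[R]_p => M j j) X_gram (@coord_continuous _ _ _ j j C)).
pose bound n : R := sigma ^+ 2 / delta ^+ 2 * (rate n * rate n) *
  \tr (n%:R^-1 *: gram n).
have bound0 : bound n @[n --> \oo] --> 0.
  have := cvgM (cvgM (cvg_cst (sigma ^+ 2 / delta ^+ 2)) (cvgM rate0 rate0)) trC.
  by rewrite mul0r mulr0 mul0r; exact.
have {}bound0 : (bound n)%:E @[n --> \oo] --> 0%E.
  by apply: cvg_EFin; [exact: nearW|exact: bound0].
apply: (squeeze_cvge _ (cvg_cst 0%E) bound0).
have := lambda_max_gt0; have := nbhs_infty_gt 0; apply: filterS2 => n n0 l0.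
rewrite measure_ge0 /=; apply: le_trans (loud_prob_le x n eps_iid _) _.
  exact: mulr_gt0.
rewrite lee_fin le_eqVlt; apply/orP; left; apply/eqP.
have nR : (0 : R) < n%:R by rewrite ltr0n.
rewrite /bound mxtraceZ /rate invf_div -expr2 expr_div_n sqr_sqrtr ?ltW //.
by field; rewrite !gt_eqF.
Qed.

Lemma score_decomposition n beta w :
  0 < n%:R :> R -> 0 < lmax n ->
  (n%:R^-1 *: gram n) *m scaled_error n beta w =
    (lmax n)^-1 *: (noise x eps n w - score n beta w).
Proof.
move=> n0 l0; rewrite -scalemxAl -scalemxAr scalerA mulrA mulVf ?gt_eqF // mul1r.
congr (_ *: _).
rewrite /noise /response -mulmxA -mulmxBr; congr (_ *m _).
rewrite mulmxBr opprB addrCA; congr (_ + _).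
by rewrite opprD addrCA subrr addr0.
Qed.

(** All bounds involve beta only through the score, which is at most lmax in
    absolute value, so a single index n serves every beta and every quiet
    outcome. *)
Lemma scaled_error_expansion (e : R) : 0 < e ->
  exists K : R, exists2 delta : R, 0 < delta &
  \forall n \near \oo, forall beta w, ~ loud x eps n (delta * lmax n) w ->
    `|scaled_error n beta w| <= K /\
    forall j, `|(C *m scaled_error n beta w) j 0 + score n beta w j 0 / lmax n| <= e.
Proof.
move=> e0; have [K K0 [eta eta0 hK]] := perturbed_inverse_bound C_posdef.
pose D := p%:R * (K * 2) + 1.
have D0 : 0 < D by rewrite ltr_wpDl // !mulr_ge0.
(* With delta <= 1 the right-hand side of the normal equations is at most 2, so
   |u| <= 2 K; the other half of e is spent on (C - X^T X / n) u. *)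
pose delta := Num.min 1 (e / 2).
have d0 : 0 < delta by rewrite lt_min ltr01 divr_gt0.
exists (K * 2), delta => //.
have rk := X_full_rank; have l0 := lambda_max_gt0; have n0 := nbhs_infty_gt 0.
have g1 := gram_near eta0; have g2 := gram_near (divr_gt0 e0 (mulr_gt0 (ltr0Sn R 1) D0)).
near=> n => beta w quiet.
have ln : 0 < lmax n by near: n.
have nn : 0 < n%:R :> R by rewrite ltr0n; near: n.
have dX : posdefmx (gram n) by apply: gram_posdef; near: n.
set u := scaled_error n beta w; set g := score n beta w.
have dec : (n%:R^-1 *: gram n) *m u = (lmax n)^-1 *: (noise x eps n w - g).
  exact: score_decomposition.
have nz j : `|noise x eps n w j 0 / lmax n| <= delta.
  rewrite normrM normfV (gtr0_norm ln) ler_pdivrMr // leNgt; apply/negP => h.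
  by apply: quiet; exists j => //=; rewrite ltW.
have gl j : `|g j 0 / lmax n| <= 1.
  rewrite normrM normfV (gtr0_norm ln) ler_pdivrMr // mul1r.
  apply: le_trans (le_lambda_max _ j).
  by have [] := lasso_score dX (lambda_ge0 n) (response (design x n) beta eps w) j.
have uK : `|u| <= K * 2.
  apply: (hK (n%:R^-1 *: gram n)) => // [|j]; first by near: n.
  rewrite dec mxE [X in _ * X]mxE [X in _ * (_ + X)]mxE mulrC mulrBl.
  apply: le_trans (ler_normB _ _) _; apply: lerD; last exact: gl.
  by apply: le_trans (nz j) _; rewrite ge_min lexx.
split => // j.
have -> : (C *m u) j 0 + g j 0 / lmax n =
    ((C - n%:R^-1 *: gram n) *m u) j 0 + noise x eps n w j 0 / lmax n.
  have -> : (C - n%:R^-1 *: gram n) *m u = C *m u - (n%:R^-1 *: gram n) *m u.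
    exact: mulmxBl.
  rewrite dec !mxE; ring.
rewrite [e]splitr; apply: le_trans (ler_normD _ _) _; apply: lerD; last first.
  by apply: le_trans (nz j) _; rewrite ge_min lexx orbT.
apply: le_trans (mulmx_norm_le _ _ _) _.
have h2 : `|C - n%:R^-1 *: gram n| <= e / (2 * D) by near: n.
apply: (@le_trans _ _ (p%:R * (e / (2 * D) * (K * 2)))).
  by rewrite ler_wpM2l // ler_pM.
have -> : p%:R * (e / (2 * D) * (K * 2)) = e / 2 * (p%:R * (K * 2) / D).
  by field; rewrite gt_eqF.
by rewrite ler_piMr ?divr_ge0 ?(ltW e0) // ler_pdivrMr // mul1r lerDl.
Unshelve. all: by end_near. Qed.

Context {lambda0 : 'cV[R]_p}.
Hypothesis lambda0_01 : forall j, 0 <= lambda0 j 0 <= 1.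

Notation covered c n beta := [set w | translate_scaled
  (lasso (design x n) (response (design x n) beta eps w) (lambda n))
  (c * (lmax n / n%:R)) (limit_set C lambda0) beta].

Lemma coveredP c n beta w : 0 < n%:R :> R -> 0 < lmax n ->
  covered c n beta w <->
  forall j, `|(C *m scaled_error n beta w) j 0| <= `|c| * lambda0 j 0.
Proof.
move=> n0 l0; have lam0 j : 0 <= lambda0 j 0 by case/andP: (lambda0_01 j).
have s0 : 0 < n%:R / lmax n by rewrite divr_gt0.
have -> : covered c n beta w <-> forall j, _ := translate_scaledP _ _ _ C_posdef lam0.
have E (t : R) j : (`|t| <= `|c * (lmax n / n%:R)| * lambda0 j 0) =
    (`|n%:R / lmax n * t| <= `|c| * lambda0 j 0).
  rewrite normrM (gtr0_norm (divr_gt0 l0 n0)) normrM (gtr0_norm s0).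
  rewrite -(ler_pM2l s0 `|t|); congr (_ <= _).
  by field; rewrite !gt_eqF.
have S j : (C *m scaled_error n beta w) j 0 = n%:R / lmax n *
    (C *m (lasso (design x n) (response (design x n) beta eps w) (lambda n) - beta)) j 0.
  by rewrite -scalemxAr [LHS]mxE.
by split => h j; move: (h j); rewrite E S.
Qed.

Lemma measurable_covered c n beta : posdefmx (gram n) ->
  measurable (covered c n beta).
Proof.
move=> dX; have lam0 j : 0 <= lambda0 j 0 by case/andP: (lambda0_01 j).
have -> : covered c n beta = [set w | [set v | forall j,
    `|(C *m (lasso (design x n) (design x n *m beta + v) (lambda n) - beta)) j 0|
      <= `|c * (lmax n / n%:R)| * lambda0 j 0] (\col_(i < n) eps i w)].
  by apply/seteqP; split => w /= /(translate_scaledP _ _ _ C_posdef lam0).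
apply: (@measurable_closed_preimage _ _ _ n (fun i => eps i)).
  by move=> i; exact: measurable_funP.
exact: closed_covered.
Qed.

Hypothesis lambda0_lim : forall j,
  (lambda n j 0 / lmax n) @[n --> \oo] --> lambda0 j 0.

Lemma min_coverage_ge0 c n : (0 <= min_coverage x eps lambda (limit_set C lambda0) c n)%E.
Proof. by apply/ereal_infP => _ [beta _ <-]; exact: measure_ge0. Qed.

(** The slack (c - 1) lambda0_j, bounded below by (c - 1) m = 2 e, pays for two
    errors of size e: one in C u = - g / lmax, one in lambda_j / lmax. *)
Lemma uniform_coverage (c : R) : 1 < c -> (forall j, 0 < lambda0 j 0) ->
  min_coverage x eps lambda (limit_set C lambda0) c n @[n --> \oo] --> 1%E.
Proof.
move=> c1 lam0_gt0; have rk := X_full_rank.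
pose m := \big[Num.min/1]_(j < p) lambda0 j 0.
have m0 : 0 < m by apply: lt_bigmin.
have mle j : m <= lambda0 j 0 by exact: bigmin_le.
pose e := (c - 1) * m / 2.
have e0 : 0 < e by rewrite !mulr_gt0 ?subr_gt0.
have [K [delta d0 exp]] := scaled_error_expansion e0.
have lim : \forall n \near \oo, forall j, lambda n j 0 / lmax n <= lambda0 j 0 + e.
  apply: filter_forall => j; apply: (cvgr_le _ (@lambda0_lim j)).
  by rewrite ltrDl.
have low : (1 - P (loud x eps n (delta * lmax n)))%E @[n --> \oo] --> 1%E.
  rewrite -[X in _ --> X]sube0; apply: cvgeB => //; first exact: cvg_cst.
  exact: loud_negligible.
apply: (squeeze_cvge _ low (cvg_cst 1%E)).
have l0 := lambda_max_gt0; have n0 := nbhs_infty_gt 0.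
near=> n; have ln : 0 < lmax n by near: n.
have nn : 0 < n%:R :> R by rewrite ltr0n; near: n.
have dX : posdefmx (gram n) by apply: gram_posdef; near: n.
have expn : forall beta w, ~ loud x eps n (delta * lmax n) w ->
    `|scaled_error n beta w| <= K /\
    forall j, `|(C *m scaled_error n beta w) j 0 + score n beta w j 0 / lmax n| <= e.
  by near: n.
have limn : forall j, lambda n j 0 / lmax n <= lambda0 j 0 + e by near: n.
have mL := measurable_loud x n (delta * lmax n) eps_iid.
apply/andP; split; last first.
  apply: ge_ereal_inf.
  exists (coverage x eps lambda (limit_set C lambda0) c n 0); first by exists 0.
  by apply: probability_le1; exact: measurable_covered.
apply/ereal_infP => _ [beta _ <-]; rewrite -probability_setC //.
apply: le_measure; rewrite ?inE; [exact: measurableC|exact: measurable_covered|].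
move=> w /= quiet; apply/coveredP => // j.
have [_ /(_ j) hj] := expn beta w quiet.
have [gl _] := lasso_score dX (lambda_ge0 n) (response (design x n) beta eps w) j.
have {}gl : `|score n beta w j 0 / lmax n| <= lambda0 j 0 + e.
  apply: (@le_trans _ _ (lambda n j 0 / lmax n)); last exact: limn.
  by rewrite normrM normfV (gtr0_norm ln) ler_pM2r ?invr_gt0.
rewrite (gtr0_norm (lt_trans ltr01 c1)).
have em : 2 * e <= (c - 1) * lambda0 j 0.
  by rewrite /e mulrC divfK ?pnatr_eq0 // ler_pM2l // subr_gt0.
have := ler_normB ((C *m scaled_error n beta w) j 0 + score n beta w j 0 / lmax n)
  (score n beta w j 0 / lmax n).
rewrite addrK; lra.
Unshelve. all: by end_near. Qed.

(** At a far positive parameter every score sits at its bound g = lambda, and at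
    the coordinate with the largest tuning parameter (C u)_j is within
    (1 - |c|) / 2 of -1, so coverage can only occur on the improbable event. *)
Lemma no_uniform_coverage (c : R) : -1 < c < 1 ->
  min_coverage x eps lambda (limit_set C lambda0) c n @[n --> \oo] --> 0%E.
Proof.
move=> /andP[cm1 c1]; have rk := X_full_rank.
have ac : `|c| < 1 by rewrite ltr_norml cm1.
pose e := (1 - `|c|) / 2.
have e0 : 0 < e by rewrite divr_gt0 ?subr_gt0.
have [K [delta d0 exp]] := scaled_error_expansion e0.
apply: (squeeze_cvge _ (cvg_cst 0%E) (loud_negligible d0)).
have l0 := lambda_max_gt0; have n0 := nbhs_infty_gt 0.
near=> n; have ln : 0 < lmax n by near: n.
have nn : 0 < n%:R :> R by rewrite ltr0n; near: n.
have dX : posdefmx (gram n) by apply: gram_posdef; near: n.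
rewrite min_coverage_ge0 /=.
(* All coordinates of this parameter exceed the estimation error, which is at
   most K lmax / n on the quiet event. *)
pose beta : 'cV[R]_p := const_mx (`|K| * (lmax n / n%:R) + 1).
apply: (@le_trans _ _ (coverage x eps lambda (limit_set C lambda0) c n beta)).
  apply: ge_ereal_inf; exists (coverage x eps lambda (limit_set C lambda0) c n beta).
    by exists beta.
  exact: lexx.
have expn : forall beta w, ~ loud x eps n (delta * lmax n) w ->
    `|scaled_error n beta w| <= K /\
    forall j, `|(C *m scaled_error n beta w) j 0 + score n beta w j 0 / lmax n| <= e.
  by near: n.
have mL := measurable_loud x n (delta * lmax n) eps_iid.
apply: le_measure; rewrite ?inE; [exact: measurable_covered|exact: mL|].
move=> w /= cov; apply: contrapT => quiet.
have {}cov := (@coveredP c n beta w nn ln).1 cov.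
have [uK hj] := expn beta w quiet.
have [j lj] := lambda_max_attained ln.
have [_ gl] := lasso_score dX (lambda_ge0 n) (response (design x n) beta eps w) j.
have bpos : 0 < lasso (design x n) (response (design x n) beta eps w) (lambda n) j 0.
  have := le_trans (entry_le_norm (scaled_error n beta w) j 0) uK.
  rewrite [X in `|X|]mxE [X in _ * X]mxE [X in _ * (_ + X)]mxE [X in _ - X]mxE.
  set b := lasso _ _ _ _ _; move=> h.
  have : b - (`|K| * (lmax n / n%:R) + 1) >= - (`|K| * (lmax n / n%:R)).
    rewrite lerNl -(ler_pM2l (divr_gt0 nn ln)).
    have -> : n%:R / lmax n * (`|K| * (lmax n / n%:R)) = `|K|.
      by field; rewrite !gt_eqF.
    rewrite mulrN; apply: le_trans (le_trans (ler_norm _) _) (ler_norm K).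
    by rewrite normrN.
  lra.
have g1 : score n beta w j 0 / lmax n = 1 by rewrite gl // lj divff ?gt_eqF.
have := hj j; rewrite g1 ler_norml => /andP[_ near1].
have up : - (C *m scaled_error n beta w) j 0 <= `|c|.
  apply: le_trans (ler_norm _) _; rewrite normrN; apply: le_trans (cov j) _.
  by have /andP[_ l1] := lambda0_01 j; rewrite ler_piMr.
by move: near1; rewrite /e; lra.
Unshelve. all: by end_near. Qed.
End consistent_tuning.

Theorem corollary14 (d0 : measure_display) (Omega : measurableType d0)
    (R : realType) (P : probability Omega R) (p : nat)
    (x : nat -> 'rV[R]_p) (C : 'M[R]_p)
    (sigma : R) (eps : nat -> {RV P >-> R})
    (lambda : nat -> 'cV[R]_p) (lambda0 : 'cV[R]_p)
    (X_full_rank : \forall n \near \oo, \rank (design x n) = p)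
    (X_gram : (n%:R^-1 *: ((design x n)^T *m design x n)) @[n --> \oo] --> C)
    (C_posdef : posdefmx C)
    (eps_iid : iid_errors sigma eps)
    (lambda_ge0 : forall n j, 0 <= lambda n j 0)
    (lambda_sqrt : exists j,
        (lambda n j 0 / Num.sqrt n%:R) @[n --> \oo] --> +oo)
    (lambda_n : forall j, (lambda n j 0 / n%:R) @[n --> \oo] --> (0 : R))
    (lambda0_01 : forall j, 0 <= lambda0 j 0 <= 1)
    (lambda0_lim : forall j,
        (lambda n j 0 / lambda_max (lambda n)) @[n --> \oo] --> lambda0 j 0) :
  (forall d : R, 1 < d -> (forall j, 0 < lambda0 j 0) ->
     min_coverage x eps lambda (limit_set C lambda0) d n @[n --> \oo] --> 1%E)
  /\
  (forall d : R, -1 < d < 1 ->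
     min_coverage x eps lambda (limit_set C lambda0) d n @[n --> \oo] --> 0%E).
Proof.
split => [d d1 lambda0_gt0|d d1].
  exact: (uniform_coverage X_full_rank X_gram C_posdef eps_iid lambda_ge0
            lambda_sqrt lambda0_01 lambda0_lim d1 lambda0_gt0).
exact: (no_uniform_coverage X_full_rank X_gram C_posdef eps_iid lambda_ge0
          lambda_sqrt lambda0_01 d1).
Qed.
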